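(* Let $G=(I,\lambda,V,(A_i)_{i\in I},J)$ be an anonymous game satisfying conditions (i)–(v) listed in the context, and with monotone cost $J$. Suppose that there exists $C>0$ such that for all $a,b\in V$ and $\eta,\eta'\in\overline{\mathrm{cov}(\mathcal P_G(V))}$: $$|J(a,\eta)-J(a,\eta')-J(b,\eta)+J(b,\eta')|\le C\,d_V(a,b)\,d_1(\eta,\eta'),\qquad |J(a,\eta)-J(a,\eta')|\le C\,d_1(\eta,\eta').$$ Let $\Psi_1\in\mathcal A$ be arbitrary, $\bar\eta_1=\eta_1=\Psi_1\sharp\lambda$, and let $(\Psi_n,\eta_n,\bar\eta_n)_{n\ge1}$ be constructed by the fictitious play procedure: for $n=1,2,\dots$, $$\Psi_{n+1}(i)=BR(i,\bar\eta_n)\ \text{ for } \lambda\text{-a.e. } i\in I,\qquad \eta_{n+1}=\Psi_{n+1}\sharp\lambda,\qquad \bar\eta_{n+1}=\tfrac{n}{n+1}\bar\eta_n+\tfrac1{n+1}\eta_{n+1}.$$ Then $d_1(\eta_n,\tilde\eta)\to0$ and $d_1(\bar\eta_n,\tilde\eta)\to0$ as $n\to\infty$, where $\tilde\eta\in\mathcal P_G(V)$ is the unique Nash equilibrium distribution.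
   Context: For a measurable space $X$, $\mathcal P(X)$ denotes the set of probability measures on $X$. $I$ (the set of players) is a topological space with its Borel $\sigma$-field, $\lambda\in\mathcal P(I)$ is non-atomic, $V$ is a metric space with distance $d_V$ and its Borel $\sigma$-field, and $A_i\subset V$ is the action set of player $i\in I$. Admissible profiles: $\mathcal A=\{\Psi:I\to V \text{ measurable}: \Psi(i)\in A_i \text{ for } \lambda\text{-a.e. } i\in I\}$, two profiles being identified if they agree $\lambda$-a.e. $\Psi\sharp\lambda$ is the push-forward of $\lambda$ by $\Psi$. $\mathcal P_G(V)=\{\eta\in\mathcal P(V): \exists\,\Psi\in\mathcal A,\ \eta=\Psi\sharp\lambda\}$. The cost is a function $J:V\times\mathcal P_G(V)\to\mathbb R$ (extended as in (ii) below). The data $G=(I,\lambda,V,(A_i)_{i\in I},J)$ is called an anonymous game. Standing assumption: there exist $M_0>0$, $v_0\in V$ such that for $\lambda$-a.e. $i\in I$ and every $a\in A_i$, $d_V(v_0,a)<M_0$. Hence $\mathcal P_G(V)\subseteq\mathcal P_1(V)=\{\eta\in\mathcal P(V):\exists v\in V,\ \int_V d_V(v,a)\,d\eta(a)<+\infty\}$, endowed with the metric $d_1(\eta_1,\eta_2)=\sup\{\int_V f\,d(\eta_1-\eta_2): f:V\to\mathbb R \text{ 1-Lipschitz}\}$. $\mathrm{cov}$ denotes convex hull and the bar denotes closure in $(\mathcal P_1(V),d_1)$. Conditions (i)–(v): (i) the correspondence $A:I\to V$, $A(i)=A_i$, is compact valued and continuous, i.e. its graph $\{(i,a): a\in A_i\}$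 is closed in $I\times V$ and for every open $U\subseteq V$ the set $\{i: A_i\cap U\neq\emptyset\}$ is open in $I$; (ii) there is an extension $J:V\times\overline{\mathrm{cov}(\mathcal P_G(V))}\to\mathbb R$ which is lower semi-continuous; (iii) $\mathrm{Min}:I\times\mathcal P_G(V)\to\mathbb R$, $\mathrm{Min}(i,\eta)=\min_{a\in A_i}J(a,\eta)$, is continuous; (iv) $\overline{\mathrm{cov}(\mathcal P_G(V))}$ is compact; (v) (Unique Minimiser condition) for every $\eta\in\overline{\mathrm{cov}(\mathcal P_G(V))}$ there is $I_\eta\subseteq I$ with $\lambda(I\setminus I_\eta)=0$ such that for all $i\in I_\eta$ there is exactly one $a\in A_i$ minimizing $J(\cdot,\eta)$ over $A_i$. Best response: $BR(i,\eta)=\arg\min_{a\in A_i}J(a,\eta)$ for $(i,\eta)\in I\times\overline{\mathrm{cov}(\mathcal P_G(V))}$ (a single point for $\lambda$-a.e. $i$). $J$ is monotone if for all $\eta,\eta'\in\overline{\mathrm{cov}(\mathcal P_G(V))}$: $\int_V|J(a,\eta)|\,d\eta'(a)<+\infty$ and $\int_V\big(J(a,\eta)-J(a,\eta')\big)\,d(\eta-\eta')(a)\ge 0$. Nash equilibrium: a profile $\tilde\Psi\in\mathcal A$ such that $\tilde\Psi(i)\in\arg\min_{a\in A_i}J(a,\tilde\Psi\sharp\lambda)$ for $\lambda$-a.e. $i\in I$; $\tilde\eta=\tilde\Psi\sharp\lambda$ is then called a Nash equilibrium distribution. *)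

(* Defs.v *)
From HB Require Import structures.
From mathcomp Require Import all_boot all_order all_algebra.
From mathcomp Require Import all_classical all_reals all_analysis.
From mathcomp Require Import measurable_realfun giry.

Set Implicit Arguments.
Unset Strict Implicit.
Unset Printing Implicit Defensive.

Import Order.TTheory GRing.Theory Num.Theory.
Import numFieldNormedType.Exports.

Local Open Scope classical_set_scope.
Local Open Scope ring_scope.

(* A [measurableType] is pointed. This is harmless here: a space that carries a
   probability measure is nonempty. *)
#[short(type="pmetricType")]
HB.structure Definition PointedMetric (K : numDomainType) :=
  {M of Metric K M & isPointed M}.

Definition borel (T : ptopologicalType) : measurableType (@open T).-sigma :=
  g_sigma_algebraType (@open T).

Definition nonatomic d (T : measurableType d) (R : realType)
    (mu : {measure set T -> \bar R}) :=
  forall A, measurable A -> (0 < mu A)%E ->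
    exists B, [/\ measurable B, B `<=` A & (0 < mu B < mu A)%E].

Section wasserstein.
Context {R : realType} (V : pmetricType R).
Local Notation PV := (probability (borel V) R).

Definition lipschitz1 (f : V -> R) := forall x y, `|f x - f y| <= mdist x y.

Definition finite_first_moment (eta : PV) :=
  exists v : V, (\int[eta]_a (mdist v a)%:E < +oo)%E.

Record P1 := MkP1 { P1_prob :> PV ; P1_moment : finite_first_moment P1_prob }.

Definition d1 (eta1 eta2 : P1) : R :=
  sup [set r | exists2 f : V -> R, lipschitz1 f &
    r = \int[eta1]_a f a - \int[eta2]_a f a].

Lemma continuous_measurable_borel (f : V -> R) :
  continuous f -> measurable_fun [set: borel V] (f : borel V -> R).
Proof.
move=> /continuousP cf.
apply: (measurability _ (RGenOpens.measurableE R)) => _ [_ [a [b ->] <-]].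
by rewrite setTI; apply: sub_sigma_algebra; exact/cf/interval_open.
Qed.

Lemma lipschitz1_continuous (f : V -> R) : lipschitz1 f -> continuous f.
Proof.
move=> lf x; apply/cvgrPdist_lt => e e0.
apply: (filterS _ (nbhsx_ballx x e e0)) => y.
by rewrite ballEmdist /=; exact/le_lt_trans/lf.
Qed.

Lemma lipschitz1_measurable (f : V -> R) :
  lipschitz1 f -> measurable_fun [set: borel V] (f : borel V -> R).
Proof.
by move=> lf; apply: continuous_measurable_borel; exact: lipschitz1_continuous.
Qed.

Lemma lipschitz1_mdist (v : V) : lipschitz1 (mdist v).
Proof.
move=> x y; rewrite ler_norml; apply/andP; split.
  by rewrite lerNl opprB lerBlDr addrC metric_triangle.
by rewrite lerBlDr addrC (metric_sym x y) metric_triangle.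
Qed.

Lemma lipschitz1_integrable (eta : P1) (f : V -> R) :
  lipschitz1 f -> eta.-integrable setT (EFin \o (f : borel V -> R)).
Proof.
move=> lf; have [v fv] := P1_moment eta.
have mdv : eta.-integrable setT (EFin \o (mdist v : borel V -> R)).
  apply/integrableP; split.
    by apply/measurable_EFinP; exact: lipschitz1_measurable (lipschitz1_mdist v).
  apply: le_lt_trans fv; rewrite le_eqVlt; apply/orP; left; apply/eqP.
  by apply: eq_integral => x _; rewrite /= ger0_norm// mdist_ge0.
have mg : eta.-integrable setT
    (EFin \o (fun a : borel V => `|f v| + mdist v a)).
  have ic : eta.-integrable setT (EFin \o (cst `|f v| : borel V -> R)).
    exact: finite_measure_integrable_cst.
  exact: (integrableD measurableT ic mdv).
apply: le_integrable mg => //.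
  by apply/measurable_EFinP; exact: lipschitz1_measurable lf.
move=> x _ /=; rewrite lee_fin [leRHS]ger0_norm ?addr_ge0 ?mdist_ge0//.
have := ler_normD (f v) (f x - f v); rewrite addrC subrK => /le_trans; apply.
by rewrite lerD2l metric_sym; exact: lf.
Qed.

Lemma d1_has_sup (eta1 eta2 : P1) :
  has_sup [set r | exists2 f : V -> R, lipschitz1 f &
    r = \int[eta1]_a f a - \int[eta2]_a f a].
Proof.
split.
  exists 0, (cst 0); first by move=> x y; rewrite subrr normr0 mdist_ge0.
  by rewrite !Rintegral_cst//= !mul0r subrr.
pose v : V := point.
exists (\int[eta1]_a mdist v a + \int[eta2]_a mdist v a) => _ [f lf ->].
have iv (eta : P1) := lipschitz1_integrable eta (lipschitz1_mdist v).
have lg : lipschitz1 (fun a => f a - f v).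
  by move=> x y; rewrite opprB addrA subrK.
have ig (eta : P1) := lipschitz1_integrable eta lg.
have fE (eta : P1) : \int[eta]_a f a = \int[eta]_a (f a - f v) + f v.
  rewrite RintegralB//; [|exact: lipschitz1_integrable
                        |exact: finite_measure_integrable_cst].
  rewrite Rintegral_cst//.
  have -> : fine (eta [set: borel V]) = 1.
    by rewrite probability_setT.
  by rewrite mulr1 subrK.
have h (eta : P1) : `|\int[eta]_a (f a - f v)| <= \int[eta]_a mdist v a.
  rewrite (le_trans (le_normr_Rintegral _ (ig eta)))//.
  apply: (le_Rintegral _ (integrable_norm (ig eta)) (iv eta)) => //.
  by move=> x _ ; rewrite metric_sym; exact: lf.
rewrite !fE opprD addrACA subrr addr0 lerD//.
  exact: le_trans (ler_norm _) (h eta1).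
by rewrite (le_trans _ (h eta2))// -normrN ler_norm.
Qed.

Lemma d1xx (eta : P1) : d1 eta eta = 0.
Proof.
rewrite /d1 (_ : [set r | _] = [set 0]) ?sup1//.
apply/seteqP; split => [_ [f _ ->]|_ ->]; first by rewrite subrr.
exists (cst 0); last by rewrite subrr.
by move=> x y; rewrite subrr normr0 mdist_ge0.
Qed.

Lemma d1_ge (eta1 eta2 : P1) (f : V -> R) : lipschitz1 f ->
  \int[eta1]_a f a - \int[eta2]_a f a <= d1 eta1 eta2.
Proof. by move=> lf; apply: sup_upper_bound; [exact: d1_has_sup|exists f]. Qed.

Lemma d1_le (eta1 eta2 : P1) (r : R) :
  (forall f, lipschitz1 f -> \int[eta1]_a f a - \int[eta2]_a f a <= r) ->
  d1 eta1 eta2 <= r.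
Proof.
move=> h; apply: ge_sup; first by case: (d1_has_sup eta1 eta2).
by move=> _ [f lf ->]; exact: h.
Qed.

Lemma d1_sym (eta1 eta2 : P1) : d1 eta1 eta2 = d1 eta2 eta1.
Proof.
suff h (e1 e2 : P1) : d1 e1 e2 <= d1 e2 e1 by apply/le_anti; rewrite !h.
apply: d1_le => f lf.
have lNf : lipschitz1 (fun a => - 1 * f a).
  by move=> x y; rewrite -mulrBr normrM normrN1 mul1r; exact: lf.
have := d1_ge e2 e1 lNf.
rewrite !RintegralZl//; [|exact: lipschitz1_integrable..].
by rewrite !mulN1r opprK addrC.
Qed.

Lemma d1_triangle (eta2 eta1 eta3 : P1) :
  d1 eta1 eta3 <= d1 eta1 eta2 + d1 eta2 eta3.
Proof.
apply: d1_le => f lf.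
rewrite -(subrK (\int[eta2]_a f a) (\int[eta1]_a f a)) -addrA lerD//.
  exact: d1_ge.
exact: d1_ge.
Qed.

HB.instance Definition _ := gen_eqMixin P1.
HB.instance Definition _ := gen_choiceMixin P1.

Let P1_ball (eta : P1) (e : R) : set P1 := [set eta' | d1 eta eta' < e].
Let P1_ent : set_system (P1 * P1) := entourage_ P1_ball.
Let P1_nbhs (eta : P1) : set_system P1 := nbhs_ P1_ent eta.

HB.instance Definition _ := hasNbhs.Build P1 P1_nbhs.

Let P1_nbhsE : (@nbhs P1 P1) = nbhs_ P1_ent.
Proof. by []. Qed.

Let P1_ball_center (eta : P1) (e : R) : 0 < e -> P1_ball eta e eta.
Proof. by move=> e0; rewrite /P1_ball/= d1xx. Qed.

Let P1_ball_sym (eta eta' : P1) (e : R) :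
  P1_ball eta e eta' -> P1_ball eta' e eta.
Proof. by rewrite /P1_ball/= d1_sym. Qed.

Let P1_ball_triangle (x y z : P1) (e1 e2 : R) :
  P1_ball x e1 y -> P1_ball y e2 z -> P1_ball x (e1 + e2) z.
Proof.
by rewrite /P1_ball/= => ? ?; rewrite (le_lt_trans (d1_triangle y _ _))// ltrD.
Qed.

Let P1_entE : P1_ent = entourage_ P1_ball. Proof. by []. Qed.

(* The topology on [P1] is that of [d1]. It is declared as a pseudometric
   because a term of type [probability] is a function on all subsets, so two
   terms may denote the same Borel measure (same values on Borel sets, [d1]
   zero) without being equal. Equality of measures is [measure_eq]. *)
HB.instance Definition _ := @Nbhs_isPseudoMetric.Build R P1
  P1_ent P1_nbhsE P1_ball P1_ball_center P1_ball_sym P1_ball_triangle P1_entE.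

End wasserstein.

Section anonymous_game.
Context {R : realType} {I : ptopologicalType} {V : pmetricType R}.
Variables (lam : probability (borel I) R) (A : I -> set V).
Implicit Types (Psi : I -> V) (eta : P1 V).

Definition admissible Psi :=
  measurable_fun [set: borel I] (Psi : borel I -> borel V) /\
  {ae lam, forall i, A i (Psi i)}.

(* [eta] is the push-forward of [lam] by [Psi]; push-forwards are only taken
   along measurable maps. *)
Definition is_law Psi eta :=
  measurable_fun [set: borel I] (Psi : borel I -> borel V) /\
  forall S : set (borel V), measurable S ->
    eta S = pushforward lam (Psi : borel I -> borel V) S.

Definition PG : set (P1 V) :=
  [set eta | exists2 Psi, admissible Psi & is_law Psi eta].

Definition cov (E : set (P1 V)) : set (P1 V) :=
  [set eta | exists (n : nat) (t : 'I_n -> R) (e : 'I_n -> P1 V),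
    [/\ forall k, 0 <= t k, \sum_(k < n) t k = 1, forall k, E (e k) &
      forall S : set (borel V), measurable S ->
        eta S = (\sum_(k < n) (t k)%:E * e k S)%E]].

Definition cov_PG : set (P1 V) := closure (cov PG).

Definition actions_bounded :=
  exists (M0 : R) (v0 : V), 0 < M0 /\
    {ae lam, forall i, forall a, A i a -> mdist v0 a < M0}.

Definition continuous_correspondence :=
  [/\ forall i, compact (A i),
      closed [set p : I * V | A p.1 p.2] &
      forall U : set V, open U -> open [set i | A i `&` U !=set0]].

(* Only the values of [J] on V * cov_PG are meaningful. *)
Variable J : V -> P1 V -> R.

(* Lower semicontinuity on V * cov_PG with the relative topology. *)
Definition cost_lsc :=
  lower_semicontinuous
    (fun p : subspace ([set: V] `*` cov_PG) => (J p.1 p.2)%:E).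

(* [m] is the minimum of [J _ eta] over [A i]; it is required to be attained. *)
Definition is_min_cost (i : I) eta (m : R) :=
  (exists2 a, A i a & J a eta = m) /\ (forall a, A i a -> m <= J a eta).

Definition continuous_Min :=
  exists Min : I * P1 V -> R,
    (forall i eta, PG eta -> is_min_cost i eta (Min (i, eta))) /\
    {within [set: I] `*` PG, continuous Min}.

Definition BR (i : I) eta : set V :=
  [set a | A i a /\ forall b, A i b -> J a eta <= J b eta].

Definition unique_minimiser :=
  forall eta, cov_PG eta ->
    {ae lam, forall i, exists! a : V, BR i eta a}.

Definition monotone_cost :=
  forall eta eta', cov_PG eta -> cov_PG eta' ->
    (\int[eta']_a `|J a eta|%:E < +oo)%E /\
    0 <= \int[eta]_a (J a eta - J a eta') - \int[eta']_a (J a eta - J a eta').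

Definition nash_equilibrium Psi eta :=
  [/\ admissible Psi, is_law Psi eta &
      {ae lam, forall i, BR i eta (Psi i)}].

Definition nash_distribution eta := exists Psi, nash_equilibrium Psi eta.

(* The sequences start at index 1; their terms of index 0 are irrelevant. *)
Definition fictitious_play (Psi : nat -> I -> V) (eta etabar : nat -> P1 V) :=
  [/\ admissible (Psi 1%N),
      is_law (Psi 1%N) (eta 1%N),
      measure_eq (etabar 1%N) (eta 1%N) &
      forall n : nat, (1 <= n)%N ->
        [/\ {ae lam, forall i, BR i (etabar n) = [set Psi n.+1 i]},
            is_law (Psi n.+1) (eta n.+1) &
            forall S : set (borel V), measurable S ->
              etabar n.+1 S = ((n%:R / n.+1%:R)%:E * etabar n S +
                               (n.+1%:R^-1)%:E * eta n.+1 S)%E]].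

End anonymous_game.

(* Main.v *)
Require Import Defs.
From HB Require Import structures.
From mathcomp Require Import all_boot all_order all_algebra.
From mathcomp Require Import all_classical all_reals all_analysis.
From mathcomp Require Import measurable_realfun giry.
From mathcomp Require Import ring lra.

Set Implicit Arguments.
Unset Strict Implicit.
Unset Printing Implicit Defensive.

Import Order.TTheory GRing.Theory Num.Theory.
Import numFieldNormedType.Exports.

Local Open Scope classical_set_scope.
Local Open Scope ring_scope.

(** The proof rests on one quantitative form of the unique minimiser condition.
Fix a distribution [u] in the closed convex hull [K] of the admissible
distributions, and let [Psi i] be the best reply of player [i] to [u]. Since
[A i] is compact, [J _ u] is lower semicontinuous and [Psi i] is its only
minimiser on [A i], for every [eps > 0] there is [D] (depending on [i]) with
  [mdist a (Psi i) <= eps + D * (J a u - J (Psi i) u)]   for all [a] in [A i]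
([linear_growth_at_strict_min]): closeness to the best reply is controlled
linearly by the excess cost. The bound survives integration over the players
([integral_growth_bound]), with a single [D] valid for countably many profiles
at once. Hence, if [e] is the law of the best reply to [u], then for every
1-Lipschitz [f] and [eps > 0] there is [D] such that
  [|int f dm - int f de| <= eps + D * (int J(.,u) dm - int J(.,u) de)]
for all [m] in a given sequence of admissible distributions
([lipschitz1_law_dist]). Being linear in [m], the inequality passes to
averages, so it also applies to the averaged play, although the averages need
not be laws of admissible profiles.

Two facts follow. The law of the best reply depends continuously on [u]
([best_reply_law_cvg]): a best reply to a nearby [w] is nearly optimal for [u],
and compactness of [K] upgrades convergence against each Lipschitz function to
convergence in [d1]. Best replies also survive limits
([best_reply_law_limit]): along [w_k -> u] the best replies converge pointwise
almost everywhere, which makes the limit profile measurable.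

Call regret the quantity
[phi_n = int J(., ubar_n) d(ubar_n) - int J(., ubar_n) d(e_(n+1))], where
[ubar_n] is the averaged play and [e_(n+1)] the law of the best reply to it.
Monotonicity and optimality give
[(n+2) phi_(n+1) <= (n+1) phi_n + L * d1 e_(n+1) e_(n+2)]
([regret_recursion]). The averages move by [O(1/n)], so by continuity of the
best reply the last distance tends to [0], and Cesaro's theorem bounds
the regret by a null sequence ([regret_bound]). If [c] is a limit point of the
averages and [e'] the law of the best reply to [c], vanishing regret inserted
in the averaged linear inequality forces [d1 c e' = 0]: [e'] is a Nash
equilibrium distribution ([averaged_play_limit_nash]). Equilibria are unique by
monotonicity ([nash_distribution_unique]), so by compactness the whole
sequence of averages converges to it, and so do the best replies. *)

(** * Metric spaces: strict minimisers and measurable limits *)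

Lemma nbhs_mdist_lt (R : realType) (V : pmetricType R) (x : V) (e : R) :
  0 < e -> \forall y \near x, mdist x y < e.
Proof.
move=> e0; apply: (filterS _ (nbhsx_ballx x e e0)) => y.
by rewrite ballEmdist.
Qed.

(** If the bound failed for every [D], there would be points [u n] of [K] with
[mdist (u n) z > eps + n * (f (u n) - f z)]. A cluster point of them lies in [K]
and is at distance at least [eps] from [z], so [f] exceeds [f z] by a fixed
amount near it, and [n] times that amount would stay bounded. *)
Lemma linear_growth_at_strict_min (R : realType) (V : pmetricType R)
    (K : set V) (f : V -> R) (z : V) (e : R) :
  compact K ->
  (forall a r, r < f a -> \forall b \near a, r < f b) ->
  (forall a, K a -> a != z -> f z < f a) -> 0 < e ->
  exists D : nat, forall a, K a -> mdist a z <= e + D%:R * (f a - f z).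
Proof.
move=> cK lscf minz e0; apply: contrapT => nD.
have /choice[u uP] (n : nat) :
    exists a, K a /\ e + n%:R * (f a - f z) < mdist a z.
  apply: contrapT => nu; apply: nD; exists n => a Ka.
  by rewrite leNgt; apply/negP => lt_a; apply: nu; exists a.
have [a [Ka cla]] := cK (u @ \oo) _
  (filterS (fun n _ => (uP n).1) (filterT : (\oo : set_system nat) setT)).
have fuz n : f z <= f (u n).
  have [->//|neq] := eqVneq (u n) z.
  by apply/ltW/minz => //; case: (uP n).
have au n : e < mdist (u n) z.
  apply: le_lt_trans (uP n).2; rewrite lerDl mulr_ge0// subr_ge0.
  exact: fuz.
(* The [u n] stay at distance more than [e] from [z]. *)
have naz : a != z.
  apply/eqP => az.
  have : (u @ \oo) (range u).
    apply: (filterS _ (filterT : (\oo : set_system nat) setT)) => n _.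
    by exists n.
  move=> /cla /(_ (nbhs_mdist_lt a e0)) [_ [[n _ <-]] ].
  by rewrite metric_sym az ltNge ltW.
pose r := (f a + f z) / 2.
have fza := minz _ Ka naz.
have rfa : r < f a by rewrite /r; lra.
have rz : 0 < r - f z by rewrite /r; lra.
pose N := Num.bound ((mdist a z + 1) / (r - f z)).
have [_ [[n Nn <-] [/= rfn dn]]] : (u @` [set n | (N <= n)%N] `&`
    ([set b | r < f b] `&` [set b | mdist a b < 1])) !=set0.
  apply: (cla _ _ _ (filterI (lscf _ _ rfa) (nbhs_mdist_lt a ltr01))).
  by exists N => [|n Nn]; [|exact: imageP].
have := (uP n).2; apply/negP; rewrite -leNgt.
have B0 : 0 <= (mdist a z + 1) / (r - f z).
  by apply: divr_ge0; [rewrite addr_ge0 ?mdist_ge0|exact: ltW].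
have Nb : mdist a z + 1 < N%:R * (r - f z).
  rewrite -ltr_pdivrMr//; have := archi_boundP B0; exact.
have nN : N%:R * (r - f z) <= n%:R * (f (u n) - f z).
  apply: ler_pM => //; [exact: ltW|by rewrite ler_nat|].
  by rewrite lerB// ltW.
have := metric_triangle (u n) a z; rewrite (metric_sym (u n) a); lra.
Qed.

(** The target need not be separable, so the distance between two measurable maps
may fail to be measurable and one argues on preimages: an open [U] is the
increasing union of the closed sets [F m] of points whose [1/(m+1)]-ball is
contained in [U], and [f x] lies in [U] iff the [h n x] eventually all lie in
some [F m]. *)
Lemma measurable_pointwise_limit d (T : measurableType d) (R : realType)
    (V : pmetricType R) (h : nat -> T -> V) (f : T -> V) :
  (forall n, measurable_fun [set: T] (h n : T -> borel V)) ->
  (forall x e, 0 < e -> \forall n \near \oo, mdist (h n x) (f x) <= e) ->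
  measurable_fun [set: T] (f : T -> borel V).
Proof.
move=> mh hf.
apply: (@measurability _ _ _ _ _ (f : T -> borel V) (@open V)) => //.
move=> _ [U oU <-]; rewrite setTI.
pose F (m : nat) : set V :=
  [set x | forall y, mdist x y < m.+1%:R^-1 -> U y].
have cF m : open (~` F m).
  rewrite openE => x /existsNP[y /not_implyP[xy nUy]].
  have e0 : 0 < m.+1%:R^-1 - mdist x y by rewrite subr_gt0.
  apply: filterS (nbhs_mdist_lt x e0) => x' /= xx' Fx'; apply: nUy; apply: Fx'.
  move: xy; have := metric_triangle x' x y; rewrite (metric_sym x' x).
  move: xx'; set r := _^-1; lra.
suff -> : f @^-1` U =
    \bigcup_m \bigcup_N \bigcap_(n in [set n | (N <= n)%N]) (h n @^-1` F m).
  apply: bigcupT_measurable => m; apply: bigcupT_measurable => N.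
  apply: bigcap_measurableType => // n _.
  rewrite -[X in measurable X]setTI; apply: mh => //.
  rewrite -[F m]setCK; apply: measurableC.
  by apply: sub_sigma_algebra; exact: cF.
apply/seteqP; split => [x /= Ufx|x [m _ [N _ hF]]].
- have /nbhs_ballP[e /= e0 eU] := open_nbhs_nbhs (conj oU Ufx).
  have e20 : 0 < e / 2 by rewrite divr_gt0.
  pose m := Num.bound (e / 2)^-1.
  have me : m.+1%:R^-1 < e / 2.
    rewrite -[ltRHS]invrK ltf_pV2 ?posrE ?invr_gt0//.
    apply: lt_trans (archi_boundP _) _; first by rewrite invr_ge0 ltW.
    by rewrite ltr_nat.
  exists m => //; have [N _ hN] := hf x _ e20.
  exists N => // n Nn y hy; apply: eU; rewrite ballEmdist /=.
  have := metric_triangle (f x) (h n x) y.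
  have := hN n Nn; rewrite /= (metric_sym (h n x) (f x)).
  by move: hy me; set r := _^-1; lra.
- have m0 : 0 < m.+1%:R^-1 / 2 :> R by rewrite divr_gt0.
  have [N' _ hN'] := hf x _ m0.
  apply: (hF (maxn N N')); first exact: leq_maxl.
  have := hN' (maxn N N') (leq_maxr _ _); rewrite /=.
  by move: m0; set r := _^-1; lra.
Qed.

(** * Comparison of integrals *)

Lemma le_Rintegral_ae d (T : measurableType d) (R : realType)
    (mu : {measure set T -> \bar R}) (f g : T -> R) :
  mu.-integrable setT (EFin \o f) -> mu.-integrable setT (EFin \o g) ->
  {ae mu, forall x, f x <= g x} -> \int[mu]_x f x <= \int[mu]_x g x.
Proof.
move=> If Ig fg; rewrite -subr_ge0 -RintegralB//.
have Igf : mu.-integrable setT (EFin \o (fun x => g x - f x)).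
  exact: (integrableB measurableT Ig If).
have mgf : measurable_fun setT (fun x => g x - f x).
  by apply/measurable_EFinP; exact: measurable_int Igf.
have -> : \int[mu]_x (g x - f x) = \int[mu]_x (Num.max (g x - f x) 0).
  congr fine; apply: ae_eq_integral => //.
  - exact/measurable_EFinP.
  - by apply/measurable_EFinP; exact: measurable_maxr.
  - apply: filterS fg => x fgx _; congr EFin.
    by rewrite max_l// subr_ge0.
by apply: Rintegral_ge0 => x _; rewrite le_max lexx orbT.
Qed.

(** The pointwise constant need not be measurable in [x], but the sets [E N] on
which the constant [N] works for all [k] are measurable and increase to a set of
full measure. Off [E N], with [N] large, the uniform bound [B] contributes at
most another [e]. *)
Lemma integral_growth_bound d (T : measurableType d) (R : realType)
    (P : probability T R) (h g : nat -> T -> R) (B e : R) :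
  (forall k, P.-integrable setT (EFin \o h k)) ->
  (forall k, P.-integrable setT (EFin \o g k)) ->
  0 < e ->
  {ae P, forall x, forall k, 0 <= g k x /\ h k x <= B} ->
  {ae P, forall x, exists D : nat, forall k, h k x <= e + D%:R * g k x} ->
  exists D : nat, forall k,
    \int[P]_x h k x <= 2 * e + D%:R * \int[P]_x g k x.
Proof.
move=> Ih Ig e0 bnd dom.
have mh k : measurable_fun setT (h k).
  by apply/measurable_EFinP; exact: measurable_int (Ih k).
have mg k : measurable_fun setT (g k).
  by apply/measurable_EFinP; exact: measurable_int (Ig k).
pose E (N : nat) : set T :=
  \bigcap_k [set x | h k x - N%:R * `|g k x| <= e].
have mE N : measurable (E N).
  apply: bigcap_measurableType => // k _.
  have mhg : measurable_fun setT (fun x => h k x - N%:R * `|g k x|).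
    apply: measurable_funB => //; apply: measurable_funM => //.
    exact: measurableT_comp.
  have := mhg measurableT _ (measurable_itv `]-oo, e]).
  by rewrite setTI; congr measurable; apply/seteqP; split=> x; rewrite /= in_itv.
have ndE : {homo E : n m / (n <= m)%N >-> (n <= m)%O}.
  move=> n m nm; apply/subsetPset => x Ex k _.
  apply: le_trans (Ex k I); rewrite /= lerB// ler_wpM2r//.
  by rewrite ler_nat.
have PE1 : P (\bigcup_N E N) = 1%E.
  have mU : measurable (\bigcup_N E N) by exact: bigcupT_measurable.
  have P0 : P (~` (\bigcup_N E N)) = 0%E.
    apply: measure_negligible; first exact: measurableC.
    apply: negligibleS (_ : P.-negligible (~` [set x |
      (forall k, 0 <= g k x /\ h k x <= B) /\
      exists D : nat, forall k, h k x <= e + D%:R * g k x])); last first.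
      by apply: filterS2 bnd dom => x.
    apply: subsetC => x [gB [D hD]]; exists D => // k _ /=.
    by rewrite lerBlDr ger0_norm//; case: (gB k).
  have := probability_setC P (measurableC mU).
  by rewrite setCK P0 sube0.
(* [B] may be nonpositive; [B'] can be divided by. *)
pose B' := Num.max B 1.
have B'0 : 0 < B' by rewrite lt_max ltr01 orbT.
have [N PN] : exists N, fine (P (~` E N)) <= e / B'.
  have : (P \o E) n @[n --> \oo] --> 1%E.
    rewrite -PE1; apply: nondecreasing_cvg_mu ndE => //.
    exact: bigcupT_measurable.
  move => /fine_cvgP[_ /cvgrPdist_lt /(_ (e / B'))].
  rewrite divr_gt0// => /(_ isT)[N _ /(_ N (leqnn N))] /= PN.
  exists N; rewrite probability_setC// fineB ?fin_num_measure//.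
  exact: le_trans (ler_norm _) (ltW PN).
exists N => k.
have Iind : P.-integrable setT (EFin \o (\1_(~` E N) : T -> R)).
  exact: (integrable_indic P (measurableC (mE N))).
pose w := fun x => e + (N%:R * g k x + B' * \1_(~` E N) x).
have Ic : P.-integrable setT (EFin \o (cst e : T -> R)).
  exact: finite_measure_integrable_cst.
have INg : P.-integrable setT (EFin \o (fun x => N%:R * g k x)).
  exact: (integrableZl measurableT _ (Ig k)).
have IBi : P.-integrable setT (EFin \o (fun x => B' * \1_(~` E N) x)).
  exact: (integrableZl measurableT _ Iind).
have Isum := integrableD measurableT INg IBi.
have Iw : P.-integrable setT (EFin \o w) := integrableD measurableT Ic Isum.
apply: le_trans (le_Rintegral_ae (Ih k) Iw _) _.
  apply: filterS bnd => x /(_ k)[g0 hB]; rewrite /w indicE.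
  have [|nEx] := pselect (E N x) => [Ex|].
    rewrite memNset; last by move=> /(_ Ex).
    have := Ex k I; rewrite /= ger0_norm// mulr0 addr0; lra.
  rewrite mem_set// mulr1; have : B <= B' by rewrite le_max lexx.
  have : 0 <= N%:R * g k x by rewrite mulr_ge0.
  lra.
rewrite /w RintegralD//= RintegralD//= !RintegralZl//.
rewrite Rintegral_cst//= probability_setT mulr1.
have -> : \int[P]_x (\1_(~` E N) x : R) = fine (P (~` E N)).
  by rewrite /Rintegral integral_indic ?setIT//; exact: measurableC.
have : B' * fine (P (~` E N)) <= e by rewrite mulrC -ler_pdivlMr.
lra.
Qed.

Lemma Rintegral_maxB d (T : measurableType d) (R : realType)
    (mu : {measure set T -> \bar R}) (f : T -> R) :
  mu.-integrable setT (EFin \o f) ->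
  \int[mu]_x f x =
    fine (\int[mu]_x (Num.max (f x) 0)%:E)
    - fine (\int[mu]_x (Num.max (- f x) 0)%:E).
Proof.
move=> If; have mf : measurable_fun setT f.
  by apply/measurable_EFinP; exact: measurable_int If.
have Imax (u : T -> R) : measurable_fun setT u ->
    (forall x, `|u x| <= `|f x|) ->
    mu.-integrable setT (EFin \o (fun x => Num.max (u x) 0)).
  move=> mu_ ule; apply: (le_integrable measurableT _ _ If).
    by apply/measurable_EFinP; exact: measurable_maxr.
  move=> x _; rewrite lee_fin; apply: le_trans (ule x).
  rewrite ger0_norm ?le_max ?lexx ?orbT//.
  by rewrite ge_max ler_norm normr_ge0.
have I1 := Imax f mf (fun x => lexx _).
have I2 : mu.-integrable setT (EFin \o (fun x => Num.max (- f x) 0)).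
  apply: Imax; first exact: measurableT_comp.
  by move=> x; rewrite normrN.
rewrite -[RHS](RintegralB measurableT I1 I2); apply: eq_Rintegral => x _.
by case: (lerP (f x) 0) => fx; case: (lerP (- f x) 0) => fx'; lra.
Qed.

(** Integrals against a measure are determined by its values on measurable sets.
It suffices to integrate the positive and negative parts of [f] against the sum
of the scaled measures. *)
Lemma Rintegral_mixture d (T : measurableType d) (R : realType)
    (mu m1 m2 : {measure set T -> \bar R}) (a b : R) (f : T -> R) :
  0 <= a -> 0 <= b ->
  (forall S, measurable S -> mu S = (a%:E * m1 S + b%:E * m2 S)%E) ->
  mu.-integrable setT (EFin \o f) ->
  m1.-integrable setT (EFin \o f) -> m2.-integrable setT (EFin \o f) ->
  \int[mu]_x f x = a * \int[m1]_x f x + b * \int[m2]_x f x.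
Proof.
move=> a0 b0 muE I0 I1 I2.
have mf : measurable_fun setT f.
  by apply/measurable_EFinP; exact: measurable_int I1.
have mixE (u : T -> R) : measurable_fun setT u -> (forall x, 0 <= u x) ->
    (forall x, u x <= `|f x|) ->
    fine (\int[mu]_x (u x)%:E) =
      a * fine (\int[m1]_x (u x)%:E) + b * fine (\int[m2]_x (u x)%:E).
  move=> mu_ u0 uf.
  have mEu : measurable_fun setT (EFin \o u) by exact/measurable_EFinP.
  have u0E x : setT x -> (0 <= (u x)%:E)%E by rewrite lee_fin.
  have fin (m : {measure set T -> \bar R}) : m.-integrable setT (EFin \o f) ->
      (\int[m]_x (u x)%:E)%E \is a fin_num.
    move=> If; apply: integrable_fin_num => //.
    apply: (le_integrable measurableT mEu _ If) => x _.
    by rewrite lee_fin ger0_norm.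
  rewrite (eq_measure_integral
    (measure_add (mscale (NngNum a0) m1) (mscale (NngNum b0) m2))); last first.
    by move=> S mS _; rewrite muE//; apply/esym; exact: measure_addE.
  rewrite ge0_integral_measure_add// !ge0_integral_mscale//=.
  by rewrite fineD ?fineM ?fin_numM ?fin.
rewrite !Rintegral_maxB// !mixE; first by lra.
- by apply: measurable_maxr => //; exact: measurableT_comp.
- by move=> x; rewrite le_max lexx orbT.
- by move=> x; rewrite ge_max -normrN ler_norm normr_ge0.
- exact: measurable_maxr.
- by move=> x; rewrite le_max lexx orbT.
- by move=> x; rewrite ge_max ler_norm normr_ge0.
Qed.

(** * The Wasserstein distance and laws of profiles *)

Section wasserstein_distance.
Context {R : realType} {V : pmetricType R}.
Implicit Types (e : P1 V) (f : V -> R).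

Lemma d1_ge0 e1 e2 : 0 <= d1 e1 e2.
Proof. by have := d1_triangle e2 e1 e1; rewrite d1xx (d1_sym e2 e1); lra. Qed.

Lemma lipschitz1_Rintegral_dist e1 e2 f : lipschitz1 f ->
  `|\int[e1]_a f a - \int[e2]_a f a| <= d1 e1 e2.
Proof.
move=> lf; rewrite ler_norml (d1_ge _ _ lf) andbT lerNl opprB d1_sym.
exact: d1_ge.
Qed.

Lemma d1_eq0 e1 e2 :
  (forall f, lipschitz1 f -> \int[e1]_a f a = \int[e2]_a f a) ->
  d1 e1 e2 = 0.
Proof.
move=> eqf; apply/eqP; rewrite eq_le d1_ge0 andbT; apply: d1_le => f lf.
by rewrite (eqf _ lf) subrr.
Qed.

Lemma measure_eq_d1 e1 e2 : measure_eq e1 e2 -> d1 e1 e2 = 0.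
Proof.
move=> e12; apply: d1_eq0 => f lf; congr fine.
by apply: eq_measure_integral => S mS _; exact: e12.
Qed.

Lemma lipschitz_Rintegral_dist (L : R) e1 e2 f : 0 <= L ->
  (forall x y, `|f x - f y| <= L * mdist x y) ->
  `|\int[e1]_a f a - \int[e2]_a f a| <= L * d1 e1 e2.
Proof.
move=> L0 lipf; have [L_gt0|] := ltP 0 L; last first.
  move=> L_le0; have {L0 L_le0}L0 : L = 0 by apply/eqP; rewrite eq_le L0 L_le0.
  have fc x : f x = f point.
    apply/eqP; rewrite -subr_eq0 -normr_le0.
    by have := lipf x point; rewrite L0 mul0r.
  have -> : f = cst (f point) by apply/funext => x; exact: fc.
  have P1E e : fine (e [set: borel V]) = 1 by rewrite probability_setT.
  by rewrite !Rintegral_cst// !P1E subrr normr0 L0 mul0r.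
have lg : lipschitz1 (fun x => L^-1 * f x).
  move=> x y; rewrite -mulrBr normrM gtr0_norm ?invr_gt0//.
  by rewrite ler_pdivrMl.
have fE e : \int[e]_a f a = L * \int[e]_a (L^-1 * f a).
  rewrite -RintegralZl//; last exact: lipschitz1_integrable.
  by apply: eq_Rintegral => x _; rewrite mulVKf// gt_eqF.
rewrite !fE -mulrBr normrM gtr0_norm// ler_pM2l//.
exact: lipschitz1_Rintegral_dist.
Qed.

(** [d1] is only a pseudometric on [P1 V], but compactness still yields a cluster
point, and balls of radius [1/(k+1)] around it give a sequence of indices. The
indices need not increase: [k <= s k] is all that limits along [s] require. *)
Lemma compact_subsequence (K : set (P1 V)) (u : nat -> P1 V) (S : set nat) :
  compact K -> (forall n, K (u n)) ->
  (forall N, exists n, (N <= n)%N /\ S n) ->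
  exists c (s : nat -> nat), [/\ K c, forall k, (k <= s k)%N,
    forall k, S (s k) & d1 (u (s k)) c @[k --> \oo] --> 0].
Proof.
move=> cK uK freq.
pose F : set_system (P1 V) :=
  [set B | exists N, forall n, (N <= n)%N -> S n -> B (u n)].
have FF : ProperFilter F.
  split; first by move=> [N]; have [n [Nn Sn]] := freq N => /(_ n Nn Sn).
  split.
  - by exists 0%N.
  - move=> B1 B2 [N1 h1] [N2 h2]; exists (maxn N1 N2) => n.
    by rewrite geq_max => /andP[n1 n2] Sn; split; [exact: h1|exact: h2].
  - by move=> B1 B2 B12 [N h]; exists N => n Nn Sn; exact/B12/h.
have FK : F K by exists 0%N => n _ _; exact: uK.
have [c [Kc clc]] := cK F FF FK.
have /choice[s sP] (k : nat) :
    exists n, [/\ (k <= n)%N, S n & d1 (u n) c < k.+1%:R^-1].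
  have k0 : 0 < k.+1%:R^-1 :> R by rewrite invr_gt0.
  have [|_ [[n [kn Sn] <-]]] := clc (u @` [set n | (k <= n)%N /\ S n])
      (ball c k.+1%:R^-1) _ (nbhsx_ballx _ _ k0).
    by exists k => n kn Sn; exact: imageP.
  by rewrite /ball /= d1_sym => dn; exists n.
exists c, s; split => //; try by move=> k; case: (sP k).
apply: (squeeze_cvgr _ (cvg_cst 0) (@cvg_harmonic R)).
by apply: nearW => k; rewrite d1_ge0 /harmonic /= ltW//; case: (sP k).
Qed.

(** Subsequence criterion: [v] is typically a distance from [u n] to some target,
and [v] needs to be controlled only along convergent subsequences of [u]. *)
Lemma compact_cvg0 (K : set (P1 V)) (u : nat -> P1 V) (v : nat -> R) :
  compact K -> (forall n, K (u n)) -> (forall n, 0 <= v n) ->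
  (forall (c : P1 V) (s : nat -> nat), K c -> (forall k, k <= s k)%N ->
     d1 (u (s k)) c @[k --> \oo] --> 0 -> v (s k) @[k --> \oo] --> 0) ->
  v n @[n --> \oo] --> 0.
Proof.
move=> cK uK v0 hv; apply/cvgrPdist_lt => eps eps0; apply: contrapT => nev.
have freq N : exists n, (N <= n)%N /\ eps <= v n.
  apply: contrapT => nN; apply: nev; exists N => // n Nn.
  rewrite /= sub0r normrN ger0_norm// ltNge; apply/negP => le_eps.
  by apply: nN; exists n.
have [c [s [Kc ks vs sc]]] :=
  compact_subsequence (S := [set n | eps <= v n]) cK uK freq.
have /cvgrPdist_lt /(_ _ eps0) [N _ /(_ N (leqnn N))] := hv c s Kc ks sc.
by rewrite /= sub0r normrN ger0_norm// ltNge => /negP; apply; exact: vs.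
Qed.

End wasserstein_distance.

Section law.
Context {R : realType} {I : ptopologicalType} {V : pmetricType R}.
Variable lam : probability (borel I) R.
Implicit Types (Psi : I -> V) (e : P1 V) (f : V -> R).

Lemma is_law_ge0_integral Psi e f : is_law lam Psi e ->
  measurable_fun setT (f : borel V -> R) -> (forall x, 0 <= f x) ->
  (\int[e]_a (f a)%:E = \int[lam]_i (f (Psi i))%:E)%E.
Proof.
move=> [mPsi lawE] mf f0.
pose X : {mfun borel I >-> borel V} :=
  HB.pack (Psi : borel I -> borel V) (isMeasurableFun.Build _ _ _ _ _ mPsi).
rewrite (eq_measure_integral (distribution lam X)); last first.
  by move=> S mS _; exact: lawE.
rewrite (ge0_integral_distribution X (f := EFin \o f))//.
exact/measurable_EFinP.
Qed.

Lemma is_law_integrable Psi e f : is_law lam Psi e ->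
  e.-integrable setT (EFin \o (f : borel V -> R)) ->
  lam.-integrable setT (EFin \o (fun i : borel I => f (Psi i))).
Proof.
move=> lawP /integrableP[/measurable_EFinP mf fin]; apply/integrableP; split.
  by apply/measurable_EFinP; apply: measurableT_comp mf _; case: lawP.
have mnf : measurable_fun setT ((fun x => `|f x|) : borel V -> R).
  exact: measurableT_comp.
have := is_law_ge0_integral lawP mnf (fun x => normr_ge0 _).
by rewrite /comp /= => <-.
Qed.

Lemma is_law_Rintegral Psi e f : is_law lam Psi e ->
  e.-integrable setT (EFin \o (f : borel V -> R)) ->
  \int[e]_a f a = \int[lam]_i f (Psi i).
Proof.
move=> lawP If; have Ifl := is_law_integrable lawP If.
have mf : measurable_fun setT (f : borel V -> R).
  by apply/measurable_EFinP; exact: measurable_int If.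
rewrite !Rintegral_maxB//; congr (fine _ - fine _).
  apply: (is_law_ge0_integral (f := fun x => Num.max (f x) 0)) => //.
    exact: measurable_maxr.
  by move=> x; rewrite le_max lexx orbT.
apply: (is_law_ge0_integral (f := fun x => Num.max (- f x) 0)) => //.
  by apply: measurable_maxr => //; exact: measurableT_comp.
by move=> x; rewrite le_max lexx orbT.
Qed.

(** The push-forward has finite first moment because the map is essentially
bounded. *)
Lemma bounded_map_law Psi (v : V) (M : R) :
  measurable_fun setT (Psi : borel I -> borel V) ->
  {ae lam, forall i, mdist v (Psi i) < M} ->
  exists e, is_law lam Psi e.
Proof.
move=> mPsi bPsi.
pose X : {mfun borel I >-> borel V} :=
  HB.pack (Psi : borel I -> borel V) (isMeasurableFun.Build _ _ _ _ _ mPsi).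
pose p : probability (borel V) R := distribution lam X.
suff fin : finite_first_moment p by exists (MkP1 fin); split.
exists v; rewrite /p.
have mdm : measurable_fun setT (mdist v : borel V -> R).
  exact: lipschitz1_measurable (lipschitz1_mdist v).
rewrite (ge0_integral_distribution X (f := EFin \o mdist v))//; first last.
- by move=> y; rewrite lee_fin mdist_ge0.
- exact/measurable_EFinP.
apply: (@le_lt_trans _ _ (\int[lam]_i (cst (Num.max M 0)%:E i))%E); last first.
  rewrite integral_cst//= [X in (_ * X)%E](_ : _ = 1%E) ?mule1 ?ltry//.
  exact: probability_setT.
apply: ae_ge0_le_integral => //=.
- by move=> i _; rewrite lee_fin mdist_ge0.
- by apply/measurable_EFinP; apply: measurableT_comp mdm _.
- by move=> i _; rewrite lee_fin le_max lexx orbT.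
- apply: (@filterS _ _ (ae_filter_ringOfSetsType lam)) bPsi => i bi _.
  by rewrite lee_fin le_max ltW.
Qed.

End law.

(** * Best replies *)

Lemma cvg_subsequence (T : topologicalType) (v : nat -> T) (l : T)
    (s : nat -> nat) :
  (forall k, k <= s k)%N -> v n @[n --> \oo] --> l ->
  v (s k) @[k --> \oo] --> l.
Proof.
move=> ks vl B /vl[N _ hN]; exists N => // k /= Nk.
by apply: hN => /=; exact: leq_trans (ks k).
Qed.

Lemma cvg_affine (R : realType) (v : nat -> R) (a b : R) :
  v n @[n --> \oo] --> 0 -> a + b * v n @[n --> \oo] --> a.
Proof.
move=> v0; rewrite -[X in _ --> X]addr0 -[X in _ + X](mulr0 b).
by apply: cvgD; [exact: cvg_cst|apply: cvgM => //; exact: cvg_cst].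
Qed.

Section best_reply.
Context {R : realType} {I : ptopologicalType} {V : pmetricType R}.
Context (lam : probability (borel I) R) (A : I -> set V) (J : V -> P1 V -> R).
Context (C : R).
Local Notation K := (cov_PG lam A).
Local Notation aeF := (ae_filter_ringOfSetsType lam).

Context (bndA : actions_bounded lam A) (cA : forall i, compact (A i))
  (lscJ : cost_lsc lam A J) (cK : compact K)
  (uniqJ : unique_minimiser lam A J)
  (finJ : forall u e, K u -> K e -> (\int[e]_a `|J a u|%:E < +oo)%E)
  (lipJ : forall a u u', K u -> K u' -> `|J a u - J a u'| <= C * d1 u u').

Implicit Types (u e : P1 V).

(** The profile is existentially quantified, so that [best_reply_law u u] is by
definition [nash_distribution lam A J u]. *)
Definition best_reply_law u e := exists Psi,
  [/\ admissible lam A Psi, is_law lam Psi e &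
      {ae lam, forall i, BR A J i u (Psi i)}].

Lemma best_reply_law_PG u e : best_reply_law u e -> PG lam A e.
Proof. by move=> [Psi [admPsi lawPsi _]]; exists Psi. Qed.

Lemma PG_cov e : PG lam A e -> cov (PG lam A) e.
Proof.
move=> PGe; exists 1%N, (fun=> 1), (fun=> e); split => //.
  by rewrite big_ord1.
by move=> S mS; rewrite big_ord1 mul1e.
Qed.

Lemma cov_cov_PG e : cov (PG lam A) e -> K e.
Proof. exact: subset_closure. Qed.

Lemma PG_cov_PG e : PG lam A e -> K e.
Proof. by move=> /PG_cov /cov_cov_PG. Qed.

(** Joint lower semicontinuity on [V * K] restricts to slices. *)
Lemma lsc_cost u a r : K u -> r < J a u -> \forall b \near a, r < J b u.
Proof.
move=> Ku rJ.
have [] := @lscJ ((a, u) : subspace ([set: V] `*` K)) r; first by rewrite lte_fin.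
move=> W; rewrite /nbhs/= -nbhs_subspace_in//= => -[[B1 B2] [/= nB1 nB2] sub] hW.
apply: filterS nB1 => b B1b.
have := hW (b, u); rewrite lte_fin; apply.
by apply: (sub (b, u)) => //; split => //=; exact: nbhs_singleton nB2.
Qed.

Lemma integrable_cost u e : K u -> K e ->
  e.-integrable setT (EFin \o (J^~ u : borel V -> R)).
Proof.
move=> Ku Ke; apply/integrableP; split; last exact: finJ.
apply/measurable_EFinP.
apply: (measurability _ (RGenOInfty.measurableE R)) => _ [_ [r ->] <-].
rewrite setTI; apply: sub_sigma_algebra; rewrite /= openE => a /=.
rewrite in_itv /= andbT => rJ.
rewrite /interior; apply: filterS (lsc_cost Ku rJ) => b.
by rewrite /= in_itv /= andbT.
Qed.

Lemma Rintegral_cost_dist u u' e : K u -> K u' -> K e ->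
  `|\int[e]_a J a u - \int[e]_a J a u'| <= C * d1 u u'.
Proof.
move=> Ku Ku' Ke.
have Iu := integrable_cost Ku Ke; have Iu' := integrable_cost Ku' Ke.
have IB : e.-integrable setT
    (EFin \o ((fun a => J a u - J a u') : borel V -> R)).
  exact: (integrableB measurableT Iu Iu').
have P1E : fine (e [set: borel V]) = 1 by rewrite probability_setT.
rewrite -(RintegralB measurableT Iu Iu').
apply: le_trans (le_normr_Rintegral measurableT IB) _.
rewrite -[leRHS]mulr1 -P1E -Rintegral_cst//.
apply: (le_Rintegral measurableT (integrable_norm IB)) => //.
  exact: finite_measure_integrable_cst.
by move=> a _; exact: lipJ.
Qed.

Lemma best_reply_law_min u e e' : K u -> best_reply_law u e -> PG lam A e' ->
  \int[e]_a J a u <= \int[e']_a J a u.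
Proof.
move=> Ku [Psi [admPsi lawPsi brPsi]] [Phi [_ AePhi] lawPhi].
have KPsi : K e by apply: PG_cov_PG; exists Psi.
have KPhi : K e' by apply: PG_cov_PG; exists Phi => //; split => //; case: lawPhi.
have IPsi := integrable_cost Ku KPsi; have IPhi := integrable_cost Ku KPhi.
rewrite (is_law_Rintegral lawPsi IPsi) (is_law_Rintegral lawPhi IPhi).
apply: le_Rintegral_ae;
  [exact: is_law_integrable lawPsi IPsi|exact: is_law_integrable lawPhi IPhi|].
apply: (@filterS2 _ _ aeF) brPsi AePhi => i [_ brPsi] APhi.
exact: brPsi.
Qed.

(** Changing [w] into [u] moves each of the two integrals of the cost by at most
[C * d1 w u], hence a best reply to [w] is optimal for [u] up to twice that. *)
Lemma best_reply_law_near_min u w e e' : K u -> K w ->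
  best_reply_law w e -> PG lam A e' ->
  \int[e]_a J a u <= \int[e']_a J a u + 2 * C * d1 w u.
Proof.
move=> Ku Kw bre PGe'.
have Ke := PG_cov_PG (best_reply_law_PG bre); have Ke' := PG_cov_PG PGe'.
have := best_reply_law_min Kw bre PGe'.
have := Rintegral_cost_dist Kw Ku Ke; have := Rintegral_cost_dist Kw Ku Ke'.
rewrite !ler_norml => /andP[? ?] /andP[? ?]; lra.
Qed.

(** [linear_growth_at_strict_min] applies because uniqueness of the best reply
makes it a strict minimiser. *)
Lemma ae_linear_growth u : K u ->
  {ae lam, forall i, forall z, BR A J i u z -> forall eps, 0 < eps ->
    exists D : nat, forall a, A i a ->
      mdist a z <= eps + D%:R * (J a u - J z u)}.
Proof.
move=> Ku; apply: (@filterS _ _ aeF) (uniqJ Ku) => i [y [_ yuniq]] z brz eps eps0.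
apply: linear_growth_at_strict_min => //.
  by move=> a r; exact: lsc_cost.
case: (brz) => _ minz a Aa az.
rewrite ltNge; apply/negP => Jaz; move/eqP: az; apply.
rewrite -(yuniq _ brz); apply/esym/yuniq; split => // b Ab.
exact/(le_trans Jaz)/minz.
Qed.

(** The constant [D] does not depend on [k], and the bound is affine in [m k]: it
therefore extends to convex combinations of the [m k]. *)
Lemma lipschitz1_law_dist u e (m : nat -> P1 V) (f : V -> R) (eps : R) :
  K u -> best_reply_law u e -> (forall k, PG lam A (m k)) ->
  lipschitz1 f -> 0 < eps ->
  exists D : nat, forall k, `|\int[m k]_a f a - \int[e]_a f a| <=
    eps + D%:R * (\int[m k]_a J a u - \int[e]_a J a u).
Proof.
move=> Ku bre PGm lf eps0.
have Ke := PG_cov_PG (best_reply_law_PG bre).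
have Km k := PG_cov_PG (PGm k).
have [Psi [[mPsi APsi] lawPsi brPsi]] := bre.
have /choice[Phi PhiP] k :
    exists Phi, admissible lam A Phi /\ is_law lam Phi (m k).
  by have [Phi] := PGm k; exists Phi.
have lawPhi k := (PhiP k).2.
have Ife := lipschitz1_integrable e lf.
have Ifm k := lipschitz1_integrable (m k) lf.
have IJe := integrable_cost Ku Ke.
have IJm k := integrable_cost Ku (Km k).
have IfPsi := is_law_integrable lawPsi Ife.
have IfPhi k := is_law_integrable (lawPhi k) (Ifm k).
have IJPsi := is_law_integrable lawPsi IJe.
have IJPhi k := is_law_integrable (lawPhi k) (IJm k).
pose h k (i : borel I) := `|f (Phi k i) - f (Psi i)|.
pose g k (i : borel I) := J (Phi k i) u - J (Psi i) u.
have If k : lam.-integrable setT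
    (EFin \o (fun i : borel I => f (Phi k i) - f (Psi i))).
  exact: (integrableB measurableT (IfPhi k) IfPsi).
have Ih k : lam.-integrable setT (EFin \o h k).
  exact: (integrable_norm (If k)).
have Ig k : lam.-integrable setT (EFin \o g k).
  exact: (integrableB measurableT (IJPhi k) IJPsi).
have APhi : {ae lam, forall i, forall k, A i (Phi k i)}.
  by apply: ae_foralln => k; case: (PhiP k) => -[].
have [M [v [M0 bM]]] := bndA.
have bnd : {ae lam, forall i, forall k, 0 <= g k i /\ h k i <= 2 * M}.
  apply: (@filterS3 _ _ aeF) bM APhi brPsi => i bM' APhi' [APsi' minPsi] k.
  split; first by rewrite subr_ge0; exact: minPsi.
  apply: le_trans (lf _ _) _.
  have := bM' _ (APhi' k); have := bM' _ APsi'.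
  have := metric_triangle (Phi k i) v (Psi i); rewrite (metric_sym _ v); lra.
have eps20 : 0 < eps / 2 by rewrite divr_gt0.
have dom : {ae lam, forall i, exists D : nat, forall k,
    h k i <= eps / 2 + D%:R * g k i}.
  apply: (@filterS3 _ _ aeF) (ae_linear_growth Ku) APhi brPsi.
  move=> i gr APhi' brPsi'.
  have [D hD] := gr _ brPsi' _ eps20; exists D => k.
  exact: le_trans (lf _ _) (hD _ (APhi' k)).
have [D hD] := integral_growth_bound Ih Ig eps20 bnd dom.
exists D => k; have := hD k; rewrite mulrC divfK// => {}hD.
rewrite (is_law_Rintegral (lawPhi k) (Ifm k)) (is_law_Rintegral lawPsi Ife).
rewrite (is_law_Rintegral (lawPhi k) (IJm k)) (is_law_Rintegral lawPsi IJe).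
rewrite -(RintegralB measurableT (IfPhi k) IfPsi).
rewrite -(RintegralB measurableT (IJPhi k) IJPsi).
exact: le_trans (le_normr_Rintegral measurableT (If k)) hD.
Qed.

(** By [lipschitz1_law_dist] and near-optimality of [m k] for [u], integrals of
Lipschitz functions against [m k] converge to those against [e], without
uniformity in the function. Compactness supplies it: every limit point of [m] in
[d1] has the same Lipschitz integrals as [e]. *)
Lemma best_reply_law_cvg u e (w m : nat -> P1 V) :
  K u -> (forall k, K (w k)) -> d1 (w k) u @[k --> \oo] --> 0 ->
  (forall k, best_reply_law (w k) (m k)) -> best_reply_law u e ->
  d1 (m k) e @[k --> \oo] --> 0.
Proof.
move=> Ku Kw wu brm bre.
have Km k := PG_cov_PG (best_reply_law_PG (brm k)).
have PGe := best_reply_law_PG bre.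
apply: (compact_cvg0 cK Km) => [n|c s Kc ks sc]; first exact: d1_ge0.
have wsu := cvg_subsequence ks wu.
suff ce0 : d1 c e = 0.
  apply: (squeeze_cvgr _ (cvg_cst 0) sc); apply: nearW => k.
  by rewrite d1_ge0 /= -[leRHS]addr0 -ce0 d1_triangle.
apply: d1_eq0 => f lf; apply/eqP; rewrite -subr_eq0 -normr_le0.
apply/ler_addgt0Pl => eps eps0; rewrite addr0.
have [D hD] := lipschitz1_law_dist Ku bre
  (fun k => best_reply_law_PG (brm (s k))) lf eps0.
pose y k := d1 (m (s k)) c + (eps + D%:R * (2 * C) * d1 (w (s k)) u).
have yeps : y k @[k --> \oo] --> eps.
  by rewrite -[eps]add0r; apply: cvgD => //; exact: cvg_affine.
apply: (cvgr_to_ge yeps); apply: nearW => k.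
have := hD k; have := lipschitz1_Rintegral_dist (m (s k)) c lf.
have := ler_wpM2l (ler0n _ D)
  (best_reply_law_near_min Ku (Kw (s k)) (brm (s k)) PGe).
rewrite /y !ler_norml mulrDr !mulrA => h1 /andP[h2 h3] /andP[h4 h5].
by apply/andP; split; lra.
Qed.

(** Best replies [Phi k] to [w k] are nearly optimal for [u], so by linear growth
they converge at almost every player to the best reply to [u]. That best reply
is thus measurable, once all maps are made constant on a measurable null set [N]
containing the exceptional players. *)
Lemma best_reply_law_limit u (w m : nat -> P1 V) :
  K u -> (forall k, K (w k)) -> d1 (w k) u @[k --> \oo] --> 0 ->
  (forall k, best_reply_law (w k) (m k)) ->
  exists e, best_reply_law u e.
Proof.
move=> Ku Kw wu /choice[Phi PhiP].
have aePhi : {ae lam, forall i, forall k, BR A J i (w k) (Phi k i)}.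
  by apply: ae_foralln => k; case: (PhiP k).
pose G := [set i | (forall k, BR A J i (w k) (Phi k i)) /\
  (exists! a, BR A J i u a) /\
  (forall z, BR A J i u z -> forall eps, 0 < eps ->
    exists D : nat, forall a, A i a ->
      mdist a z <= eps + D%:R * (J a u - J z u))].
have [N [mN lamN subN]] : lam.-negligible (~` G).
  apply: (@filterS3 _ _ aeF) aePhi (uniqJ Ku) (ae_linear_growth Ku) => i.
  by move=> ? ? ?; split.
have NG i : ~ N i -> G i by move=> nNi; apply: contrapT => /subN.
pose Psi i := if i \in N then point else xget point (BR A J i u).
pose Phi' k i := if i \in N then point else Phi k i.
have brPsi i : ~ N i -> BR A J i u (Psi i).
  move=> nNi; rewrite /Psi memNset//.
  have [_ [[a [bra _]] _]] := NG _ nNi.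
  exact: (xgetPex point (ex_intro _ a bra)).
have mPhi' k : measurable_fun [set: borel I] (Phi' k : borel I -> borel V).
  apply: measurable_fun_ifT => //; last by case: (PhiP k) => -[].
  apply: (measurable_fun_bool true); rewrite setTI.
  by rewrite (_ : _ @^-1` _ = N)//; apply/seteqP; split => i /=;
    [exact: set_mem|exact: mem_set].
have mPsi : measurable_fun [set: borel I] (Psi : borel I -> borel V).
  apply: (measurable_pointwise_limit mPhi') => i eps eps0.
  have [iN|/negP] := boolP (i \in N).
    by apply: nearW => k; rewrite /Phi' /Psi iN mdistxx ltW.
  move=> iN; have nNi : ~ N i by move=> /mem_set.
  have [brPhi [_ gr]] := NG _ nNi; have brz := brPsi _ nNi.
  have eps20 : 0 < eps / 2 by rewrite divr_gt0.
  have [D hD] := gr _ brz _ eps20.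
  pose y k := eps / 2 + D%:R * (2 * C) * d1 (w k) u.
  have yeps : y k @[k --> \oo] --> eps / 2 by exact: cvg_affine.
  have epslt : eps / 2 < eps by lra.
  have [N0 _ hN0] := cvgr_lt _ yeps _ epslt; exists N0 => // k /hN0 yk /=.
  apply: le_trans (ltW yk); rewrite {1}/Phi' memNset//.
  have [Ak mink] := brPhi k; apply: le_trans (hD _ Ak) _.
  rewrite /y lerD2l -mulrA ler_wpM2l//.
  have := mink _ brz.1.
  have := lipJ (Phi k i) (Kw k) Ku; have := lipJ (Psi i) (Kw k) Ku.
  rewrite !ler_norml => /andP[? ?] /andP[? ?]; lra.
have nNae : {ae lam, forall i, ~ N i}.
  by exists N; split => // i /contrapT.
have brae : {ae lam, forall i, BR A J i u (Psi i)}.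
  by apply: (@filterS _ _ aeF) nNae => i; exact: brPsi.
have [M [v [_ bM]]] := bndA.
have bPsi : {ae lam, forall i, mdist v (Psi i) < M}.
  by apply: (@filterS2 _ _ aeF) bM brae => i bMi [APsi _]; exact: bMi.
have [e lawe] := bounded_map_law mPsi bPsi.
exists e, Psi; split => //; split => //.
by apply: (@filterS _ _ aeF) brae => i [].
Qed.

End best_reply.

(** * Uniqueness of the equilibrium and convergence of the play *)

(** Summing the recursion, [phi n] is at most the mean of
[phi 0, eps 0, ..., eps (n-1)], which tends to [0] by Cesaro's theorem. *)
Lemma subaveraging_bound (R : realType) (phi eps : nat -> R) :
  (forall n, n.+2%:R * phi n.+1 <= n.+1%:R * phi n + eps n) ->
  eps n @[n --> \oo] --> 0 ->
  exists2 b : nat -> R, (forall n, phi n <= b n) & b n @[n --> \oo] --> 0.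
Proof.
move=> phiS eps0; pose v n := if n is k.+1 then eps k else phi 0%N.
exists (arithmetic_mean v); last by apply: cesaro; rewrite -cvg_shiftS.
move=> n; rewrite /arithmetic_mean /= ler_pdivlMl//.
elim: n => [|n IHn]; first by rewrite /series /= big_nat1 mul1r.
apply: le_trans (phiS n) _; rewrite /series /= big_nat_recr//=.
by rewrite lerD2r.
Qed.

Lemma squeeze_add_cvg0 (R : realType) (a b v : nat -> R) :
  (forall n, 0 <= v n <= a n + b n) -> a n @[n --> \oo] --> 0 ->
  b n @[n --> \oo] --> 0 -> v n @[n --> \oo] --> 0.
Proof.
move=> vab a0 b0; have sum0 : a n + b n @[n --> \oo] --> 0.
  by rewrite -[X in _ --> X](addr0 0); exact: cvgD.
by apply: (squeeze_cvgr _ (cvg_cst 0) sum0); exact: nearW.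
Qed.

Section uniqueness.
Context {R : realType} {I : ptopologicalType} {V : pmetricType R}.
Context (lam : probability (borel I) R) (A : I -> set V) (J : V -> P1 V -> R).
Local Notation K := (cov_PG lam A).
Local Notation aeF := (ae_filter_ringOfSetsType lam).
Context (lscJ : cost_lsc lam A J)
  (uniqJ : unique_minimiser lam A J)
  (finJ : forall u e, K u -> K e -> (\int[e]_a `|J a u|%:E < +oo)%E).

(** The two laws of a measurable set are integrals of almost everywhere equal
indicator functions. *)
Lemma ae_eq_law (Phi Psi : I -> V) e e' :
  is_law lam Phi e -> is_law lam Psi e' ->
  {ae lam, forall i, Phi i = Psi i} -> measure_eq e e'.
Proof.
move=> lawPhi lawPsi PhiPsi S mS.
have mind : measurable_fun setT (\1_S : borel V -> R).
  exact: measurable_indic.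
have ind0 x : 0 <= (\1_S : V -> R) x by rewrite indicE.
have eE (m : P1 V) : m S = (\int[m]_x ((\1_S : V -> R) x)%:E)%E.
  by rewrite integral_indic// setIT.
apply: eq_trans (eE e) (eq_trans _ (esym (eE e'))).
rewrite (is_law_ge0_integral lawPhi mind ind0).
rewrite (is_law_ge0_integral lawPsi mind ind0).
apply: ae_eq_integral => //.
- by apply/measurable_EFinP; apply: measurableT_comp mind _; case: lawPhi.
- by apply/measurable_EFinP; apply: measurableT_comp mind _; case: lawPsi.
- by apply: (@filterS _ _ aeF) PhiPsi => i -> _.
Qed.

(** The excess cost of the profile with law [e'] over the best reply is
nonnegative with nonpositive integral. It vanishes almost everywhere, so both profiles pick
the unique minimiser. *)
Lemma best_reply_law_unique_min u e e' : K u -> best_reply_law lam A J u e ->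
  PG lam A e' -> \int[e']_a J a u <= \int[e]_a J a u -> measure_eq e' e.
Proof.
move=> Ku bre PGe' le_e'e.
have Ke := PG_cov_PG (best_reply_law_PG bre); have Ke' := PG_cov_PG PGe'.
have [Psi [admPsi lawPsi brPsi]] := bre.
have [Phi [_ APhi] lawPhi] := PGe'.
apply: (ae_eq_law lawPhi lawPsi).
have IPsi := is_law_integrable lawPsi (integrable_cost lscJ finJ Ku Ke).
have IPhi := is_law_integrable lawPhi (integrable_cost lscJ finJ Ku Ke').
pose g (i : borel I) := J (Phi i) u - J (Psi i) u.
have Ig : lam.-integrable setT (EFin \o g).
  exact: (integrableB measurableT IPhi IPsi).
have g0 : {ae lam, forall i, 0 <= g i}.
  apply: (@filterS2 _ _ aeF) APhi brPsi => i APhi' [_ minPsi].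
  by rewrite subr_ge0; exact: minPsi.
have intg : \int[lam]_i `|g i| = 0.
  apply/eqP; rewrite eq_le; apply/andP; split; last exact: Rintegral_ge0.
  apply: (@le_trans _ _ (\int[lam]_i g i)).
    apply: (le_Rintegral_ae (integrable_norm Ig) Ig).
    by apply: (@filterS _ _ aeF) g0 => i gi0; rewrite /= ger0_norm.
  rewrite (RintegralB measurableT IPhi IPsi) subr_le0.
  rewrite -(is_law_Rintegral lawPhi (integrable_cost lscJ finJ Ku Ke')).
  by rewrite -(is_law_Rintegral lawPsi (integrable_cost lscJ finJ Ku Ke)).
have g_eq0 : {ae lam, forall i, g i = 0}.
  have mg : measurable_fun setT (EFin \o g) by exact: measurable_int Ig.
  have /(ae_eq_integral_abs lam measurableT mg) :
      (\int[lam]_i `|(EFin \o g) i|)%E = 0%E.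
    have fin : (\int[lam]_i `|(EFin \o g) i|)%E \is a fin_num.
      exact: (integrable_fin_num measurableT (integrable_abse Ig)).
    by rewrite -(fineK fin); congr EFin; exact: intg.
  by apply: (@filterS _ _ aeF) => i /(_ Logic.I) [].
have APhi0 := @filterI _ _ aeF _ _ APhi g_eq0.
apply: (@filterS3 _ _ aeF) (uniqJ Ku) APhi0 brPsi => i.
move=> [y [_ yuniq]] [APhi' /eqP]; rewrite subr_eq0 => /eqP JE brPsi'.
rewrite -(yuniq _ brPsi'); apply/esym/yuniq; split=> // b Ab; rewrite JE.
by case: brPsi' => _; exact.
Qed.

(** Each equilibrium minimises its own cost, so the integral of
[J _ e - J _ e'] against [e - e'] is nonpositive. Monotonicity makes it zero, and
then [e] is also optimal for the cost [J _ e']. *)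
Lemma nash_distribution_unique e e' : monotone_cost lam A J ->
  nash_distribution lam A J e -> nash_distribution lam A J e' ->
  measure_eq e e'.
Proof.
move=> monJ Ne Ne'.
have PGe := best_reply_law_PG Ne; have PGe' := best_reply_law_PG Ne'.
have Ke := PG_cov_PG PGe; have Ke' := PG_cov_PG PGe'.
apply: (best_reply_law_unique_min Ke' Ne' PGe).
have [_] := monJ _ _ Ke Ke'.
rewrite !RintegralB//; try exact: (integrable_cost lscJ finJ).
have := best_reply_law_min lscJ finJ Ke Ne PGe'; lra.
Qed.

End uniqueness.

(** Here [e n] and [u n] stand for the distributions of rank [n.+1] in the play,
which gives both sequences a meaningful term of index [0]. *)
Section averaged_play.
Context {R : realType} {I : ptopologicalType} {V : pmetricType R}.
Context (lam : probability (borel I) R) (A : I -> set V) (J : V -> P1 V -> R).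
Context (C : R).
Local Notation K := (cov_PG lam A).
Local Notation aeF := (ae_filter_ringOfSetsType lam).

Context (bndA : actions_bounded lam A) (cA : forall i, compact (A i))
  (lscJ : cost_lsc lam A J) (cK : compact K)
  (uniqJ : unique_minimiser lam A J) (monJ : monotone_cost lam A J)
  (C0 : 0 < C)
  (lipJ : forall a u u', K u -> K u' -> `|J a u - J a u'| <= C * d1 u u')
  (lip2J : forall a b u u', K u -> K u' ->
     `|J a u - J a u' - J b u + J b u'| <= C * mdist a b * d1 u u').
Context (e u : nat -> P1 V).
Context (PGe0 : PG lam A (e 0%N)) (u0E : measure_eq (u 0%N) (e 0%N))
  (brS : forall n, best_reply_law lam A J (u n) (e n.+1))
  (uSE : forall n (S : set (borel V)), measurable S ->
     u n.+1 S = ((n.+1%:R / n.+2%:R)%:E * u n S +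
                 (n.+2%:R^-1)%:E * e n.+1 S)%E).

Let finJ u' e' : K u' -> K e' -> (\int[e']_a `|J a u'|%:E < +oo)%E.
Proof. by move=> Ku Ke; case: (monJ Ku Ke). Qed.

Let PGe n : PG lam A (e n).
Proof. by case: n => // n; exact: best_reply_law_PG (brS n). Qed.

Let Ke n : K (e n). Proof. exact: PG_cov_PG. Qed.
Arguments Ke : clear implicits.

Lemma averaged_playE n (S : set (borel V)) : measurable S ->
  u n S = (\sum_(k < n.+1) (n.+1%:R^-1)%:E * e k S)%E.
Proof.
move=> mS; elim: n => [|n IHn].
  by rewrite big_ord1 invr1 mul1e; exact: u0E.
rewrite uSE// IHn [RHS]big_ord_recr/=; congr (_ + _)%E.
rewrite ge0_sume_distrr; last first.
  by move=> k _; rewrite mule_ge0// lee_fin.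
apply: eq_bigr => k _; rewrite muleA -EFinM; congr (_%:E * _)%E.
by rewrite mulrAC mulfV// mul1r.
Qed.

Let Ku n : K (u n).
Proof.
apply: cov_cov_PG; exists n.+1, (fun=> n.+1%:R^-1), (fun k => e k); split => //.
  by rewrite sumr_const card_ord -[LHS]mulr_natr mulVf.
by move=> S; exact: averaged_playE.
Qed.
Arguments Ku : clear implicits.

Let Rintegral_u0 (f : V -> R) : \int[u 0%N]_a f a = \int[e 0%N]_a f a.
Proof. by congr fine; apply: eq_measure_integral => S mS _; exact: u0E. Qed.

Let Rintegral_uS n (f : V -> R) :
  (forall m, K m -> m.-integrable setT (EFin \o (f : borel V -> R))) ->
  \int[u n.+1]_a f a = n.+1%:R / n.+2%:R * \int[u n]_a f a
    + n.+2%:R^-1 * \int[e n.+1]_a f a.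
Proof.
move=> If; apply: Rintegral_mixture; try exact: If.
- by rewrite divr_ge0.
- by rewrite invr_ge0.
- exact: uSE.
Qed.

Let IJ n m : K m -> m.-integrable setT (EFin \o (J^~ (u n) : borel V -> R)).
Proof. exact: (integrable_cost lscJ finJ (Ku n)). Qed.

(** Almost all actions lie in one ball, whose diameter bounds the distance between
any two admissible laws. *)
Lemma PG_d1_bounded : exists2 L : R, 0 <= L &
  forall e1 e2, PG lam A e1 -> PG lam A e2 -> d1 e1 e2 <= L.
Proof.
have [M [v [M0 bM]]] := bndA; exists (2 * M); first lra.
move=> e1 e2 [Phi [_ APhi] lawPhi] [Psi [_ APsi] lawPsi].
apply: d1_le => f lf.
have I1 := lipschitz1_integrable e1 lf; have I2 := lipschitz1_integrable e2 lf.
rewrite (is_law_Rintegral lawPhi I1) (is_law_Rintegral lawPsi I2).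
have IPhi := is_law_integrable lawPhi I1.
have IPsi := is_law_integrable lawPsi I2.
rewrite -(RintegralB measurableT IPhi IPsi).
have P1E : fine (lam [set: borel I]) = 1 by rewrite probability_setT.
have -> : 2 * M = \int[lam]_(_ in setT) (2 * M).
  by rewrite Rintegral_cst// P1E mulr1.
apply: le_Rintegral_ae.
- exact: (integrableB measurableT IPhi IPsi).
- exact: finite_measure_integrable_cst.
apply: (@filterS3 _ _ aeF) bM APhi APsi => i bM' /bM' h1 /bM' h2.
apply: le_trans (ler_norm _) _; apply: le_trans (lf _ _) _.
have := metric_triangle (Phi i) v (Psi i); rewrite (metric_sym _ v) /=; lra.
Qed.

(** [u n.+1 - u n] is [(e n.+1 - u n) / (n+2)], and [e n.+1] stays at bounded
distance from the average [u n] of admissible laws. *)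
Lemma averaged_play_step : exists2 L : R, 0 <= L &
  forall n, n.+2%:R * d1 (u n.+1) (u n) <= L.
Proof.
have [L L0 hL] := PG_d1_bounded; exists L => // n.
have bnd f e' k : lipschitz1 f -> PG lam A e' ->
    \int[e']_a f a - \int[u k]_a f a <= L.
  move=> lf PGe'; elim: k => [|k IHk].
    by rewrite Rintegral_u0; apply: le_trans (d1_ge _ _ lf) _; exact: hL.
  rewrite Rintegral_uS; last by move=> m _; exact: lipschitz1_integrable.
  have hk : \int[e']_a f a - \int[e k.+1]_a f a <= L.
    by apply: le_trans (d1_ge _ _ lf) _; exact: hL.
  set x := \int[e']_a f a in IHk hk *.
  set y := \int[u k]_a f a in IHk *; set z := \int[e k.+1]_a f a in hk *.
  have -> : x - (k.+1%:R / k.+2%:R * y + k.+2%:R^-1 * z) =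
      k.+2%:R^-1 * (k.+1%:R * (x - y) + (x - z)).
    by field.
  rewrite ler_pdivrMl// [k.+2%:R]mulrSr mulrDl mul1r lerD//.
  by rewrite ler_wpM2l.
rewrite mulrC -ler_pdivlMr//; apply: d1_le => f lf.
rewrite Rintegral_uS; last by move=> m _; exact: lipschitz1_integrable.
rewrite ler_pdivlMr//; apply: le_trans (bnd f _ n lf (PGe n.+1)).
rewrite le_eqVlt; apply/orP; left; apply/eqP.
set y := \int[u n]_a f a; set z := \int[e n.+1]_a f a.
by field.
Qed.

Lemma averaged_play_step_cvg0 : d1 (u n.+1) (u n) @[n --> \oo] --> 0.
Proof.
have [L L0 hL] := averaged_play_step.
have L0cvg : L * n.+1%:R^-1 @[n --> \oo] --> 0.
  rewrite -[X in _ --> X](mulr0 L); apply: cvgM; first exact: cvg_cst.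
  exact: cvg_harmonic.
apply: (squeeze_cvgr _ (cvg_cst 0) L0cvg); apply: nearW => n.
rewrite d1_ge0 /= ler_pdivlMr// mulrC.
apply: le_trans (hL n); rewrite ler_wpM2r ?d1_ge0//.
by rewrite ler_nat.
Qed.

(** Along a convergent subsequence of averages, [u n] and [u n.+1] have the same
limit, hence so do the laws [e n.+1] and [e n.+2] of their best replies. *)
Lemma best_reply_step_cvg0 : d1 (e n.+1) (e n.+2) @[n --> \oo] --> 0.
Proof.
apply: (compact_cvg0 cK Ku) => [n|c s Kc ks sc]; first exact: d1_ge0.
have [e' bre'] := best_reply_law_limit bndA cA lscJ uniqJ lipJ Kc
  (fun k => Ku (s k)) sc (fun k => brS (s k)).
have cvg1 := best_reply_law_cvg bndA cA lscJ cK uniqJ finJ lipJ Kc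
  (fun k => Ku (s k)) sc (fun k => brS (s k)) bre'.
have sc' : d1 (u (s k).+1) c @[k --> \oo] --> 0.
  apply: squeeze_add_cvg0 (cvg_subsequence ks averaged_play_step_cvg0) sc => k.
  by rewrite d1_ge0 /= d1_triangle.
have cvg2 := best_reply_law_cvg bndA cA lscJ cK uniqJ finJ lipJ Kc
  (fun k => Ku (s k).+1) sc' (fun k => brS (s k).+1) bre'.
apply: squeeze_add_cvg0 cvg1 cvg2 => k.
by rewrite d1_ge0 /= (d1_sym (e (s k).+2)) d1_triangle.
Qed.

Definition regret n := \int[u n]_a J a (u n) - \int[e n.+1]_a J a (u n).

(** Write [g = J _ (u n.+1) - J _ (u n)]. Monotonicity between [u n.+1] and [u n]
says that the integral of [g] against [e n.+1 - u n] is nonnegative, which turns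
the increment of [(n+1) * regret n] into at most [n+2] times the integral of
[J _ (u n.+1)] against [e n.+1 - e n.+2]. As [e n.+1] is optimal for [u n], that
integral is at most that of [g] against the same difference, and [g] is Lipschitz
with constant [C * d1 (u n.+1) (u n)]. This is where the
factor [1/(n+2)] is gained. *)
Lemma regret_recursion : exists L : R, forall n,
  n.+2%:R * regret n.+1 <= n.+1%:R * regret n + L * d1 (e n.+1) (e n.+2).
Proof.
have [L L0 hL] := averaged_play_step; exists (C * L) => n.
have mon := (monJ (Ku n.+1) (Ku n)).2.
have IB m : K m ->
    m.-integrable setT
      (EFin \o ((fun a => J a (u n.+1) - J a (u n)) : borel V -> R)).
  by move=> Km; exact: (integrableB measurableT (IJ n.+1 Km) (IJ n Km)).
have intB m : K m -> \int[m]_a (J a (u n.+1) - J a (u n)) =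
    \int[m]_a J a (u n.+1) - \int[m]_a J a (u n).
  by move=> Km; exact: (RintegralB measurableT (IJ n.+1 Km) (IJ n Km)).
move: mon; rewrite (Rintegral_uS n IB) !intB//.
have mix := Rintegral_uS n (IJ n.+1).
have opt := best_reply_law_min lscJ finJ (Ku n) (brS n) (PGe n.+2).
have lipB : \int[e n.+1]_a (J a (u n.+1) - J a (u n))
    - \int[e n.+2]_a (J a (u n.+1) - J a (u n)) <=
    C * d1 (u n.+1) (u n) * d1 (e n.+1) (e n.+2).
  apply: le_trans (ler_norm _) _; apply: lipschitz_Rintegral_dist.
    by rewrite mulr_ge0 ?d1_ge0// ltW.
  move=> a b; rewrite opprB addrA [leRHS]mulrAC.
  apply: le_trans (lip2J a b (Ku n.+1) (Ku n)).
  by rewrite le_eqVlt; apply/orP; left; apply/eqP; congr `|_|; ring.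
rewrite !intB// in lipB.
have step : n.+2%:R * (C * d1 (u n.+1) (u n) * d1 (e n.+1) (e n.+2)) <=
    C * L * d1 (e n.+1) (e n.+2).
  rewrite mulrA ler_wpM2r ?d1_ge0// mulrCA ler_wpM2l ?(ltW C0)//.
rewrite /regret mix.
set d := d1 (e n.+1) (e n.+2) in lipB step *.
set dd := d1 (u n.+1) (u n) in lipB step *.
set x1 := \int[u n]_a J a (u n.+1); set x0 := \int[u n]_a J a (u n).
set y1 := \int[e n.+1]_a J a (u n.+1) in lipB *.
set y0 := \int[e n.+1]_a J a (u n) in lipB opt *.
set z1 := \int[e n.+2]_a J a (u n.+1) in lipB *.
set z0 := \int[e n.+2]_a J a (u n) in lipB opt *.
move=> mon.
have N0 : 0 < n.+2%:R :> R by [].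
have mon' : x1 - x0 <= y1 - y0.
  rewrite -subr_ge0 -(pmulr_rge0 _ (_ : 0 < n.+2%:R^-1)) ?invr_gt0//.
  apply: le_trans mon _; rewrite le_eqVlt; apply/orP; left; apply/eqP.
  by field.
have xyz : n.+2%:R * (y1 - z1) <= n.+2%:R * (C * dd * d).
  by rewrite ler_pM2l//; lra.
have NE : n.+2%:R = n.+1%:R + 1 :> R by rewrite mulrSr.
have n0 : 0 <= n.+1%:R :> R by [].
have := ler_wpM2l n0 (_ : x1 - x0 + y0 - z1 <= y1 - z1).
move=> /(_ ltac:(lra)) bracket.
have -> : n.+2%:R * (n.+1%:R / n.+2%:R * x1 + n.+2%:R^-1 * y1 - z1) =
    n.+1%:R * x1 + y1 - n.+2%:R * z1 by field.
move: xyz step; rewrite NE; move: bracket.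
set N := n.+1%:R; move: (C * dd * d) (C * L * d) => p q; lra.
Qed.

Lemma regret_bound : exists2 b : nat -> R,
  (forall n, regret n <= b n) & b n @[n --> \oo] --> 0.
Proof.
have [L hL] := regret_recursion; apply: (subaveraging_bound hL).
rewrite -[X in _ --> X](mulr0 L); apply: cvgM; first exact: cvg_cst.
exact: best_reply_step_cvg0.
Qed.

Lemma best_reply_law_congr c c' e' : K c -> K c' -> d1 c c' = 0 ->
  best_reply_law lam A J c e' -> best_reply_law lam A J c' e'.
Proof.
move=> Kc Kc' cc' [Psi [admPsi lawPsi brPsi]]; exists Psi; split => //.
have JE a : J a c = J a c'.
  apply/eqP; rewrite -subr_eq0 -normr_le0.
  by have := lipJ a Kc Kc'; rewrite cc' mulr0.
apply: (@filterS _ _ aeF) brPsi => i [APsi minPsi]; split => // b Ab.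
by rewrite -!JE; exact: minPsi.
Qed.

(** The gap between [u n] and [e'] for the cost [J _ c] is at most the regret plus
[2 * C * d1 (u n) c], which vanishes along [s]. The averaged form [hDu] of
[lipschitz1_law_dist] then identifies [c] with the law [e'] of its best reply. *)
Lemma averaged_play_limit_nash c (s : nat -> nat) :
  K c -> (forall k, k <= s k)%N -> d1 (u (s k)) c @[k --> \oo] --> 0 ->
  exists2 e', nash_distribution lam A J e' & d1 c e' = 0.
Proof.
move=> Kc ks sc.
have [e' bre'] := best_reply_law_limit bndA cA lscJ uniqJ lipJ Kc
  (fun k => Ku (s k)) sc (fun k => brS (s k)).
have PGe' := best_reply_law_PG bre'; have Ke' := PG_cov_PG PGe'.
suff ce' : d1 c e' = 0 by exists e' => //; exact: best_reply_law_congr bre'.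
apply: d1_eq0 => f lf; apply/eqP; rewrite -subr_eq0 -normr_le0.
apply/ler_addgt0Pl => eps eps0; rewrite addr0.
have [D hD] := lipschitz1_law_dist bndA cA lscJ uniqJ finJ Kc bre' PGe lf eps0.
have hDu n : `|\int[u n]_a f a - \int[e']_a f a| <=
    eps + D%:R * (\int[u n]_a J a c - \int[e']_a J a c).
  elim: n => [|n IHn]; first by rewrite !Rintegral_u0.
  rewrite (Rintegral_uS n (fun m _ => lipschitz1_integrable m lf)).
  rewrite (Rintegral_uS n
    (fun m Km => integrable_cost lscJ finJ Kc (e := m) Km)).
  set p := n.+1%:R / n.+2%:R; set q := n.+2%:R^-1.
  have p0 : 0 <= p by rewrite divr_ge0.
  have q0 : 0 <= q by rewrite invr_ge0.
  have pq : p = 1 - q by rewrite /p /q; field.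
  clearbody p q; move: (hD n.+1) IHn.
  set E := \int[e']_a f a; set E' := \int[e']_a J a c.
  set x := \int[u n]_a f a; set x' := \int[u n]_a J a c.
  set z := \int[e n.+1]_a f a; set z' := \int[e n.+1]_a J a c => hz hx.
  have -> : p * x + q * z - E = p * (x - E) + q * (z - E) by rewrite pq; ring.
  have -> : eps + D%:R * (p * x' + q * z' - E') =
      p * (eps + D%:R * (x' - E')) + q * (eps + D%:R * (z' - E')).
    by rewrite pq; ring.
  apply: le_trans (ler_normD _ _) _.
  rewrite !normrM (ger0_norm p0) (ger0_norm q0).
  by apply: lerD; apply: ler_wpM2l.
have [b hb b0] := regret_bound.
pose y k := d1 (u (s k)) c +
  ((eps + D%:R * b (s k)) + D%:R * (2 * C) * d1 (u (s k)) c).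
have yeps : y k @[k --> \oo] --> eps.
  rewrite -[eps]add0r -[X in _ + X]addr0.
  rewrite -[X in _ + (_ + X)](mulr0 (D%:R * (2 * C))).
  apply: cvgD => //; apply: cvgD.
    by apply: cvg_affine; exact: cvg_subsequence b0.
  by apply: cvgM => //; exact: cvg_cst.
apply: (cvgr_to_ge yeps); apply: nearW => k; set n := s k.
have := hDu n; have := lipschitz1_Rintegral_dist (u n) c lf.
have gap : \int[u n]_a J a c - \int[e']_a J a c <= b n + 2 * C * d1 (u n) c.
  have := hb n; rewrite /regret.
  have := best_reply_law_min lscJ finJ (Ku n) (brS n) PGe'.
  have := Rintegral_cost_dist lscJ finJ lipJ (Ku n) Kc (Ku n).
  have := Rintegral_cost_dist lscJ finJ lipJ (Ku n) Kc Ke'.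
  by rewrite !ler_norml => /andP[? ?] /andP[? ?]; lra.
have := ler_wpM2l (ler0n _ D) gap.
rewrite /y -/n !ler_norml mulrDr !mulrA => h1 /andP[h2 h3] /andP[h4 h5].
by apply/andP; split; lra.
Qed.

(** All limit points of the averages are equilibria, hence equal, and the laws of
the best replies follow by continuity. *)
Lemma averaged_play_cvg_nash : exists eN,
  [/\ nash_distribution lam A J eN, d1 (u n) eN @[n --> \oo] --> 0 &
      d1 (e n) eN @[n --> \oo] --> 0].
Proof.
have [c [s [Kc ks _ sc]]] := compact_subsequence (S := setT) cK Ku
  (fun N => ex_intro _ N (conj (leqnn N) Logic.I)).
have [eN NeN _] := averaged_play_limit_nash Kc ks sc.
have KeN := PG_cov_PG (best_reply_law_PG NeN).
have ueN : d1 (u n) eN @[n --> \oo] --> 0.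
  apply: (compact_cvg0 cK Ku) => [n|c' s' Kc' ks' sc']; first exact: d1_ge0.
  have [e' Ne' c'e'] := averaged_play_limit_nash Kc' ks' sc'.
  have e'eN := measure_eq_d1
    (nash_distribution_unique lscJ uniqJ finJ monJ Ne' NeN).
  apply: (squeeze_cvgr _ (cvg_cst 0) sc'); apply: nearW => k.
  have := d1_triangle c' (u (s' k)) eN; have := d1_triangle e' c' eN.
  by rewrite c'e' e'eN d1_ge0 /=; lra.
exists eN; split => //; rewrite -cvg_shiftS.
exact: (best_reply_law_cvg bndA cA lscJ cK uniqJ finJ lipJ KeN Ku ueN brS NeN).
Qed.

End averaged_play.

Theorem theorem3p1 (R : realType) (I : ptopologicalType) (V : pmetricType R)
    (lam : probability (borel I) R) (A : I -> set V) (J : V -> P1 V -> R)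
    (Hnonatomic : nonatomic lam)
    (Hbounded : actions_bounded lam A)
    (Hi : continuous_correspondence A)
    (Hii : cost_lsc lam A J)
    (Hiii : continuous_Min lam A J)
    (Hiv : compact (cov_PG lam A))
    (Hv : unique_minimiser lam A J)
    (Hmonotone : monotone_cost lam A J)
    (HLipschitz : exists2 C : R, 0 < C &
      forall (a b : V) (eta eta' : P1 V),
        cov_PG lam A eta -> cov_PG lam A eta' ->
        `|J a eta - J a eta' - J b eta + J b eta'|
          <= C * mdist a b * d1 eta eta' /\
        `|J a eta - J a eta'| <= C * d1 eta eta')
    (Psi : nat -> I -> V) (eta etabar : nat -> P1 V)
    (Hplay : fictitious_play lam A J Psi eta etabar) :
  exists etaN : P1 V,
    [/\ PG lam A etaN,
        nash_distribution lam A J etaN,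
        forall eta' : P1 V,
          nash_distribution lam A J eta' -> measure_eq eta' etaN,
        d1 (eta n) etaN @[n --> \oo] --> 0 &
        d1 (etabar n) etaN @[n --> \oo] --> 0].
Proof.
have [C C0 lipJ] := HLipschitz; have [cA _ _] := Hi.
have [adm1 law1 etabar1 play] := Hplay.
have finJ u e : cov_PG lam A u -> cov_PG lam A e ->
    (\int[e]_a `|J a u|%:E < +oo)%E.
  by move=> Ku Ke; case: (Hmonotone _ _ Ku Ke).
have PG1 : PG lam A (eta 1%N) by exists (Psi 1%N).
have brS n : best_reply_law lam A J (etabar n.+1) (eta n.+2).
  have [brPsi lawPsi _] := play n.+1 isT.
  have br : {ae lam, forall i, BR A J i (etabar n.+1) (Psi n.+2 i)}.
    by apply: (@filterS _ _ (ae_filter_ringOfSetsType lam)) brPsi => i ->.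
  exists (Psi n.+2); split => //; split; first by case: lawPsi.
  by apply: (@filterS _ _ (ae_filter_ringOfSetsType lam)) br => i [].
have [etaN [NetaN cvgbar cvgeta]] := averaged_play_cvg_nash Hbounded cA Hii Hiv
  Hv Hmonotone C0 (fun a u u' Ku Ku' => (lipJ a a u u' Ku Ku').2)
  (fun a b u u' Ku Ku' => (lipJ a b u u' Ku Ku').1)
  (e := fun n => eta n.+1) (u := fun n => etabar n.+1) PG1 etabar1 brS
  (fun n => let: And3 _ _ h := play n.+1 isT in h).
exists etaN; split => //.
- exact: best_reply_law_PG NetaN.
- by move=> eta' Neta'; exact: nash_distribution_unique Neta' NetaN.
- by rewrite -cvg_shiftS.
- by rewrite -cvg_shiftS.
Qed.
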